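(* Let $K$ be a monoid with submonoids $G$ and $H$ such that $K=G\bowtie H$. If $K$ is a Garside monoid, then the submonoids $G$ and $H$ act on each other by bijections; that is, for all $h\in H$ the maps $g\mapsto h\triangleright g$ and $g\mapsto g\blacktriangleleft h$ from $G$ to $G$ are bijections, and for all $g\in G$ the maps $h\mapsto h\triangleleft g$ and $h\mapsto g\blacktriangleright h$ from $H$ to $H$ are bijections.
   Context: Zappa–Szép product: for a monoid $K$ with submonoids $G,H$, write $K=G\bowtie H$ if for every $k\in K$ there exist unique $g_1,g_2\in G$ and $h_1,h_2\in H$ such that $g_1h_1=k=h_2g_2$. Actions: for $g\in G$, $h\in H$ the elements $h\triangleright g\in G$, $h\triangleleft g\in H$, $g\blacktriangleright h\in H$, $g\blacktriangleleft h\in G$ are defined by $hg=(h\triangleright g)(h\triangleleft g)$ and $gh=(g\blacktriangleright h)(g\blacktriangleleft h)$. Garside monoids: in a monoid $M$ with identity $\mathbf 1$, write $x\preccurlyeq y$ ($x$ is a prefix of $y$) if $y=xu$ for some $u\in M$, and $y\succcurlyeq x$ ($x$ is a suffix of $y$) if $y=ux$ for some $u\in M$. An atom is an element $a\neq\mathbf 1$ such that $a=uv$ implies $u=\mathbf 1$ or $v=\mathbf 1$. $M$ is atomic if it is generated by its atoms and for each $x\in M$ there is an upper bound on the lengths of decompositions of $x$ as a product of atoms. An element is balanced if its set of prefixes equals its set of suffixes; this common set is denoted $\mathrm{Div}(d)$. A Garside structure is a pair $(M,\Delta)$ where $M$ is a cancellative atomic monoid, the prefix and suffix relations are lattice orders,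 $\Delta\in M$ is balanced, $M$ is generated by $\mathrm{Div}(\Delta)$, and $\mathrm{Div}(\Delta)$ is finite. $M$ is a Garside monoid if such a $\Delta$ exists. *)

(* Defs.v *)
From mathcomp Require Import all_boot.
From mathcomp Require Import boolp classical_sets functions cardinality.
From Corelib Require Import Relations.Relation_Definitions.

Set Implicit Arguments.
Unset Strict Implicit.
Unset Printing Implicit Defensive.

Local Open Scope classical_set_scope.
Local Open Scope group_scope.

Section GarsideMonoids.
Variable M : monoidType.
Implicit Types (x y d : M) (A : set M).

Definition prefix_of x y := exists u, y = x * u.

Definition suffix_of x y := exists u, y = u * x.

Definition atom x := x <> 1 /\ forall u v, x = u * v -> u = 1 \/ v = 1.

Definition submonoid A := A 1 /\ forall x y, A x -> A y -> A (x * y).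

Definition generates A := smallest submonoid A = setT.

(* A decomposition of x as a product of atoms is a list s of atoms whose
   ordered product is x; its length is size s. *)
Definition atomic :=
  generates [set x | atom x] /\
  forall x, exists n, forall s : seq M,
    (forall a, a \in s -> atom a) -> \prod_(a <- s) a = x -> (size s <= n)%N.

Definition cancellative :=
  right_injective (@mul M) /\ left_injective (@mul M).

Definition balanced d :=
  [set x | prefix_of x d] = [set x | suffix_of x d].

(* Only meaningful for balanced d, when it is also the set of suffixes. *)
Definition Div d : set M := [set x | prefix_of x d].

End GarsideMonoids.

Section LatticeOrders.
Variables (T : Type) (R : T -> T -> Prop).

Definition is_join x y z :=
  R x z /\ R y z /\ forall w, R x w -> R y w -> R z w.

Definition is_meet x y z :=
  R z x /\ R z y /\ forall w, R w x -> R w y -> R w z.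

Definition lattice_order :=
  Relation_Definitions.order T R /\
  forall x y, (exists z, is_join x y z) /\ (exists z, is_meet x y z).

End LatticeOrders.

Record Garside_structure (M : monoidType) (Delta : M) : Prop := {
  Garside_cancellative : cancellative M;
  Garside_atomic : atomic M;
  Garside_prefix_lattice : lattice_order (@prefix_of M);
  Garside_suffix_lattice : lattice_order (@suffix_of M);
  Garside_balanced : balanced Delta;
  Garside_generated : generates (Div Delta);
  Garside_finite : finite_set (Div Delta)
}.

Definition Garside_monoid (M : monoidType) :=
  exists Delta : M, Garside_structure Delta.

Section ZappaSzep.
Variable K : monoidType.
Implicit Types (A B G H : set K) (g h k : K).

Definition factorizations A B k : set (K * K) :=
  [set p | [/\ A p.1, B p.2 & k = p.1 * p.2]].

Definition Zappa_Szep G H :=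
  forall k, (exists! p, factorizations G H k p) /\
            (exists! q, factorizations H G k q).

(* The factorization of k in A B; the default value (1, 1) is returned only
   when there is none, which does not happen if K is the Zappa-Szep product
   of A and B. *)
Definition factor A B k : K * K := xget (1, 1) (factorizations A B k).

(* The four actions are total functions on K, meaningful for g in G and
   h in H: h g = (h |> g) (h <| g) with h |> g (rtri) in G and h <| g (ltri)
   in H, and g h = (g |>> h) (g <<| h) with g |>> h (brtri) in H and g <<| h
   (bltri) in G, the doubled symbols being the black triangles. *)
Definition rtri G H h g : K := (factor G H (h * g)).1.
Definition ltri G H h g : K := (factor G H (h * g)).2.
Definition brtri G H g h : K := (factor H G (g * h)).1.
Definition bltri G H g h : K := (factor H G (g * h)).2.

End ZappaSzep.

(* Main.v *)
Require Import Defs.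
From mathcomp Require Import all_boot.
From mathcomp Require Import boolp classical_sets functions cardinality.
From HB Require Import structures.

(** The factorizations $k = g_1 h_1 = h_2 g_2$ exhibit $k$ as the join of $g_1$
and $h_2$ for the prefix order; so [h |> g] and [h] determine [h g], hence [g],
which is injectivity.  For surjectivity, the $G$-parts (and the $H$-parts) of the
two factorizations of the Garside element $\Delta$ coincide, which implies that
[h g] divides $\Delta$ whenever [h] and [g] do.  Thus $g \mapsto h \triangleright g$ is an injective
self-map of the finite set of divisors of $\Delta$ in $G$, and therefore onto it;
as these divisors generate, the rest follows by multiplicativity.  The three
other actions are obtained by exchanging $G$ and $H$ and by passing to the opposite
monoid. *)

Set Implicit Arguments.
Unset Strict Implicit.
Unset Printing Implicit Defensive.

Local Open Scope classical_set_scope.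
Local Open Scope group_scope.

Lemma finite_set_inj_surj (T : eqType) (A : set T) (f : T -> T) :
  finite_set A -> set_fun A A f -> set_inj A f -> set_surj A A f.
Proof.
move=> /finite_seqP[s ->] fA injf y /= ys.
have u : uniq (map f (undup s)).
  rewrite map_inj_in_uniq ?undup_uniq // => x z; rewrite !mem_undup => xs zs.
  by apply: injf; rewrite inE.
have sub : {subset map f (undup s) <= undup s}.
  by move=> _ /mapP[x xs ->]; rewrite mem_undup; apply: fA; rewrite /= -mem_undup.
have [|_ E] := uniq_min_size u sub; first by rewrite size_map.
move: ys; rewrite -mem_undup -E => /mapP[x xs ->].
by exists x => //=; rewrite -mem_undup.
Qed.

(** * The opposite monoid *)

Definition opposite (M : Type) : Type := M.

Section Opposite.
Variable M : monoidType.

HB.instance Definition _ := Choice.on (opposite M).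

Fact opposite_mulA : associative (fun x y : opposite M => (y : M) * x).
Proof. by move=> x y z; rewrite mulgA. Qed.

Fact opposite_mul1g : left_id (1 : M) (fun x y : opposite M => (y : M) * x).
Proof. by move=> x; rewrite mulg1. Qed.

Fact opposite_mulg1 : right_id (1 : M) (fun x y : opposite M => (y : M) * x).
Proof. by move=> x; rewrite mul1g. Qed.

HB.instance Definition _ := isMonoid.Build (opposite M)
  opposite_mulA opposite_mul1g opposite_mulg1.

Lemma opposite_submonoid (A : set M) :
  submonoid (A : set (opposite M)) <-> submonoid A.
Proof. by split=> -[A1 AM]; split=> // x y Ax Ay; apply: AM. Qed.

Lemma opposite_generates (A : set M) :
  generates A -> generates (A : set (opposite M)).
Proof.
rewrite /generates => <-; congr smallest.
by apply/funext => B; apply/propext/opposite_submonoid.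
Qed.

Lemma opposite_atom (a : M) : atom (a : opposite M) <-> atom a.
Proof.
by split=> -[a1 aP]; split=> // u v /aP [->|->]; [right|left|right|left].
Qed.

Lemma opposite_prod (s : seq M) :
  \prod_(a <- (s : seq (opposite M))) a = \prod_(a <- rev s) a.
Proof.
elim: s => [|x s IH]; first by rewrite !big_nil.
by rewrite big_cons rev_cons big_rcons /= -IH.
Qed.

Lemma opposite_Garside (D : M) :
  Garside_structure D -> Garside_structure (D : opposite M).
Proof.
case=> -[lc rc] [gen bnd] pl sl bal gD fD.
(* Balancedness gives [D] the same divisors for both multiplications. *)
have DE : Div (D : opposite M) = Div D by rewrite /Div bal.
split=> //; rewrite ?DE //; last exact: opposite_generates.
split.
  rewrite (_ : [set x | _] = [set x : M | atom x]); last first.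
    by apply/funext => x; apply/propext/opposite_atom.
  exact: opposite_generates.
move=> x; have [n nP] := bnd x; exists n => s sA sx.
rewrite -size_rev; apply: nP; last by rewrite -opposite_prod.
by move=> a; rewrite mem_rev => /sA /opposite_atom.
Qed.

Lemma opposite_Zappa_Szep (G H : set M) :
  Zappa_Szep G H ->
  Zappa_Szep (G : set (opposite M)) (H : set (opposite M)).
Proof.
have flip (A B : set M) (k : M) : (exists! p, factorizations A B k p) ->
    exists! q, factorizations (B : set (opposite M)) (A : set (opposite M)) k q.
  move=> -[[a b] [[/= Aa Bb ->] u]]; exists (b, a); split=> // -[b' a'].
  by move=> [/= Bb' Aa' E]; have [-> ->] := u (a', b') (And3 Aa' Bb' E).
by move=> Z k; have [/flip ? /flip ?] := Z k.
Qed.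

End Opposite.

(** * Unique factorizations in a Zappa-Szép product *)

Lemma Zappa_SzepC (K : monoidType) (G H : set K) :
  Zappa_Szep G H -> Zappa_Szep H G.
Proof. by move=> Z k; have [] := Z k. Qed.

Section ZappaSzepTheory.
Variables (K : monoidType) (G H : set K).
Hypotheses (hG : submonoid G) (hH : submonoid H) (hK : Zappa_Szep G H).

Lemma factorP k : factorizations G H k (factor G H k).
Proof. by apply: xgetPex; have [[p [pP _]] _] := hK k; exists p. Qed.

Lemma GH_decomp k : exists g h, [/\ G g, H h & k = g * h].
Proof. by exists (factor G H k).1, (factor G H k).2; apply: factorP. Qed.

Lemma HG_decomp k : exists h g, [/\ H h, G g & k = h * g].
Proof. by have [_ [[h g] [[Hh Gg kE] _]]] := hK k; exists h, g. Qed.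

Lemma GH_uniq g h g' h' : G g -> H h -> G g' -> H h' ->
  g * h = g' * h' -> g = g' /\ h = h'.
Proof.
move=> Gg Hh Gg' Hh' E; have [[p [_ u]] _] := hK (g * h).
by have := u (g', h') (And3 Gg' Hh' E); rewrite (u (g, h) (And3 Gg Hh erefl)) => -[].
Qed.

Lemma HG_uniq h g h' g' : H h -> G g -> H h' -> G g' ->
  h * g = h' * g' -> h = h' /\ g = g'.
Proof.
move=> Hh Gg Hh' Gg' E; have [_ [p [_ u]]] := hK (h * g).
by have := u (h', g') (And3 Hh' Gg' E); rewrite (u (h, g) (And3 Hh Gg erefl)) => -[].
Qed.

Lemma factorE g h : G g -> H h -> factor G H (g * h) = (g, h).
Proof.
move=> Gg Hh; have := factorP (g * h); case: factor => a b [/= Ga Hb E].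
by have [-> ->] := GH_uniq Gg Hh Ga Hb E.
Qed.

Lemma GH_trivial w : G w -> H w -> w = 1.
Proof.
by move=> Gw Hw; have [|] := GH_uniq Gw hH.1 hG.1 Hw; first rewrite mulg1 mul1g.
Qed.

Lemma rtri_G h g : G (rtri G H h g).
Proof. by have [] := factorP (h * g). Qed.

Lemma mul_rtri_ltri h g : h * g = rtri G H h g * ltri G H h g.
Proof. by have [] := factorP (h * g). Qed.

Lemma ltri_H h g : H (ltri G H h g).
Proof. by have [] := factorP (h * g). Qed.

End ZappaSzepTheory.

(** * Divisors of the Garside element *)

Section GarsideTheory.
Variables (K : monoidType) (D : K).
Hypothesis garside : Garside_structure D.

Definition factor_closed (A : set K) := forall x y, A (x * y) -> A x /\ A y.

Lemma Garside_mulI (x : K) : injective (mul x).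
Proof. by have [/(_ x)] := Garside_cancellative garside. Qed.

Lemma Garside_conical (x y : K) : x * y = 1 -> x = 1 /\ y = 1.
Proof.
move=> E; have [[_ _ anti] _] := Garside_prefix_lattice garside.
have x1 : x = 1 by apply: anti; [exists y | exists x; rewrite mul1g].
by split=> //; rewrite -E x1 mul1g.
Qed.

Lemma Div_suffix u v : D = u * v -> Div D v.
Proof.
by move=> E; rewrite /Div (Garside_balanced garside); exists u.
Qed.

Lemma Div_factor u v w : D = u * (v * w) -> Div D v.
Proof.
by move=> /Div_suffix [t E]; exists (w * t); rewrite E mulgA.
Qed.

Lemma Div_suffixP v : Div D v -> exists u, D = u * v.
Proof. by rewrite /Div (Garside_balanced garside) => -[u ->]; exists u. Qed.

(** The induction runs on [A x -> P x]: closure under factors passes membership in [A] from a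
    product to both of its factors. *)
Lemma Div_ind (A P : set K) : factor_closed A -> submonoid P ->
  (forall d, Div D d -> A d -> P d) -> A `<=` P.
Proof.
move=> fA [P1 PM] PD x; move: (I : setT x).
rewrite -(Garside_generated garside) => gx; move: x gx.
apply: smallest_sub PD; split=> // x y Px Py /[dup] Axy /fA [Ax Ay].
by apply: PM; [apply: Px | apply: Py].
Qed.

(* Writing [q = x * p], left translation by [x] is an injective self-map of the
finite set [A `&` Div D], so it takes the value [1]. *)
Lemma Div_extremal (A : set K) (p q : K) : factor_closed A -> A 1 -> A p -> A q ->
  Div D p -> Div D q ->
  (forall d, A d -> Div D d -> prefix_of d p) ->
  (forall d, A d -> Div D d -> suffix_of d q) -> p = q.
Proof.
move=> fA A1 Ap Aq Dp [t Dt] pre suf; have [x qx] := suf p Ap Dp.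
have fin : finite_set (A `&` Div D).
  by apply: sub_finite_set (Garside_finite garside) => ? [].
have self : set_fun (A `&` Div D) (A `&` Div D) (mul x).
  move=> d [Ad /(pre d Ad) [z pz]]; have qz : q = x * d * z by rewrite qx pz mulgA.
  split; first by have [] := fA (x * d) z; rewrite -?qz.
  by exists (z * t); rewrite Dt qz mulgA.
have D1 : Div D 1 by exists D; rewrite mul1g.
have surj := finite_set_inj_surj fin self (in2W (@Garside_mulI x)).
have [//|d _ /Garside_conical[x1 _]] := surj 1.
by rewrite qx x1 mul1g.
Qed.

End GarsideTheory.

(** * The components of the Garside element *)

Section FactorClosed.
Variables (K : monoidType) (G H : set K) (D : K).
Hypotheses (hG : submonoid G) (hH : submonoid H) (hK : Zappa_Szep G H).
Hypothesis garside : Garside_structure D.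

(** Write [u = h * g] and push [g] through [v]: then [u * v = (h * h') * g'], while [1 * (u * v)] is
    another such factorization. Hence [h * h' = 1], and [h = 1] because only [1] divides [1]. The
    argument for [v] is the mirror image. *)
Lemma Zappa_Szep_factor_closed : factor_closed G.
Proof.
move=> u v Guv; split.
  have [h [g [Hh Gg uE]]] := HG_decomp hK u.
  have [h' [g' [Hh' Gg' gvE]]] := HG_decomp hK (g * v).
  have [|E _] := HG_uniq hK (hH.2 _ _ Hh Hh') Gg' hH.1 Guv.
  - by rewrite mul1g uE -[RHS]mulgA gvE mulgA.
  - by have [h1 _] := Garside_conical garside E; rewrite uE h1 mul1g.
have [g [h [Gg Hh vE]]] := GH_decomp hK v.
have [g' [h' [Gg' Hh' ugE]]] := GH_decomp hK (u * g).
have [|_ E] := GH_uniq hK Gg' (hH.2 _ _ Hh' Hh) Guv hH.1.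
- by rewrite mulg1 vE !mulgA ugE.
- by have [_ h1] := Garside_conical garside E; rewrite vE h1 mulg1.
Qed.

(** If [d] in [G] is a prefix of [D], factoring the cofactor in [G] and [H] and invoking uniqueness
    makes [d] a prefix of the left [G]-part [p] of [D]; suffixes likewise end the right [G]-part
    [q]. Then [Div_extremal] identifies [p] with [q]. *)
Lemma Garside_part : exists q, [/\ G q,
  exists2 h, H h & D = q * h, exists2 h, H h & D = h * q,
  (forall d, G d -> Div D d -> prefix_of d q) &
  (forall d, G d -> Div D d -> suffix_of d q)].
Proof.
have [p [b [Gp Hb DE]]] := GH_decomp hK D.
have [h [q [Hh Gq DE']]] := HG_decomp hK D.
have pfx d : G d -> Div D d -> prefix_of d p.
  move=> Gd [u Du]; have [g [c [Gg Hc uE]]] := GH_decomp hK u.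
  exists g; have [|//] := GH_uniq hK Gp Hb (hG.2 _ _ Gd Gg) Hc.
  by rewrite -DE Du uE mulgA.
have sfx d : G d -> Div D d -> suffix_of d q.
  move=> Gd /(Div_suffixP garside) [u Du].
  have [c [g [Hc Gg uE]]] := HG_decomp hK u.
  exists g; have [|//] := HG_uniq hK Hh Gq Hc (hG.2 _ _ Gg Gd).
  by rewrite -DE' Du uE mulgA.
have pq : p = q.
  apply: (Div_extremal garside Zappa_Szep_factor_closed hG.1) => //.
    by exists b.
  exact: Div_suffix DE'.
by exists q; split=> //; [exists b; rewrite -?pq | exists h | rewrite -pq].
Qed.

End FactorClosed.

(** * Bijectivity of the action of [H] on [G] *)

Section Actions.
Variables (K : monoidType) (G H : set K) (D : K).
Hypotheses (hG : submonoid G) (hH : submonoid H) (hK : Zappa_Szep G H).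
Hypothesis garside : Garside_structure D.

Let hK' := Zappa_SzepC hK.
Let closedG := Zappa_Szep_factor_closed hH hK garside.
Let closedH := Zappa_Szep_factor_closed hG hK' garside.

(** Here [D = r * q] with [r] its [H]-part and [q] its [G]-part. As [h] ends [r] and [g] begins [q],
    the product [h * g] sits in the middle of [D]. *)
Lemma Div_mulHG h g : H h -> G g -> Div D h -> Div D g -> Div D (h * g).
Proof.
move=> Hh Gg Dh Dg.
have [q [Gq _ [b Hb DE] pre _]] := Garside_part hG hH hK garside.
have [r [Hr [a Ga DE'] _ _ suf]] := Garside_part hH hG hK' garside.
have [|rb _] := HG_uniq hK Hb Gq Hr Ga; first by rewrite -DE.
have [u rE] := suf h Hh Dh; have [v qE] := pre g Gg Dg.
by apply: (Div_factor garside (u := u) (w := v)); rewrite DE rb rE qE !mulgA.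
Qed.

(* The join of [h |> g] and [h] is a common prefix of [h * g] and [h * g']
whose complement in either one lies in both [G] and [H]. *)
Lemma rtri_inj h : H h -> set_inj G (rtri G H h).
Proof.
move=> Hh g g'; rewrite !inE => Gg Gg' E; set a := rtri G H h g in E.
have [_ /(_ a h) [[m [[x mx] [[y my] mP]]] _]] := Garside_prefix_lattice garside.
have joinE f : G f -> rtri G H h f = a -> h * f = m.
  move=> Gf fa; have := mul_rtri_ltri hK h f; rewrite fa => E0.
  have [||w mw] := mP (h * f); [by exists (ltri G H h f) | by exists f |].
  have Hw : H w.
    have cE : x * w = ltri G H h f.
      by apply: (Garside_mulI garside (x := a)); rewrite mulgA -mx -mw.
    by have [] := @closedH x w; rewrite ?cE //; apply: ltri_H.
  have Gw : G w.
    suff fE : y * w = f by have [] := @closedG y w; rewrite ?fE.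
    by apply: (Garside_mulI garside (x := h)); rewrite mulgA -my -mw.
  by rewrite mw (GH_trivial hG hH hK Gw Hw) mulg1.
by apply: (Garside_mulI garside (x := h)); rewrite !joinE.
Qed.

Lemma rtri_surj_Div h a : H h -> Div D h -> G a -> Div D a ->
  exists g h', [/\ G g, H h', Div D h' & h * g = a * h'].
Proof.
move=> Hh Dh Ga Da.
have fin : finite_set (G `&` Div D).
  by apply: sub_finite_set (Garside_finite garside) => ? [].
have self : set_fun (G `&` Div D) (G `&` Div D) (rtri G H h).
  move=> g [Gg Dg]; split; first exact: rtri_G.
  have [t Dt] := Div_mulHG Hh Gg Dh Dg; exists (ltri G H h g * t).
  by rewrite Dt mulgA -(mul_rtri_ltri hK).
have inj : set_inj (G `&` Div D) (rtri G H h).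
  by move=> g g'; rewrite !inE => -[Gg _] [Gg' _]; apply: rtri_inj; rewrite ?inE.
have [g [Gg Dg] <-] := finite_set_inj_surj fin self inj (conj Ga Da).
exists g, (ltri G H h g); split=> //; [exact: ltri_H| |exact: mul_rtri_ltri].
(* The new [H]-factor divides [D] too, which lets [rtri_surj] iterate. *)
have [t] := Div_mulHG Hh Gg Dh Dg; rewrite (mul_rtri_ltri hK h g) -mulgA.
exact: Div_factor.
Qed.

Lemma rtri_surj h a : H h -> G a -> exists g h', [/\ G g, H h' & h * g = a * h'].
Proof.
(* First induction: [a] becomes arbitrary while [h] stays a divisor of [D]; the factor [h'] left
   over from [x] acts next, towards [y]. *)
pose Q := [set a | forall h, H h -> Div D h ->
  exists g h', [/\ G g, H h', Div D h' & h * g = a * h']].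
have GQ : G `<=` Q.
  apply: (Div_ind garside closedG) => [|d Dd Gd c Hc Dc]; last exact: rtri_surj_Div.
  split=> [c Hc Dc|x y Qx Qy c Hc Dc].
    by exists 1, c; split=> //; [exact: hG.1|rewrite mulg1 mul1g].
  have [g [c' [Gg Hc' Dc' E]]] := Qx c Hc Dc.
  have [g' [c2 [Gg' Hc2 Dc2 E']]] := Qy c' Hc' Dc'.
  exists (g * g'), c2; split=> //; first exact: hG.2.
  by rewrite mulgA E -!mulgA E'.
(* Second induction: [h] becomes arbitrary; the preimage under [x] is the target for [y]. *)
pose P := [set h | forall a, G a -> exists g h', [/\ G g, H h' & h * g = a * h']].
suff HP : H `<=` P by move=> Hh Ga; exact: HP.
apply: (Div_ind garside closedH) => [|d Dd Hd c Gc]; last first.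
  by have [g [h' []]] := GQ c Gc d Hd Dd; exists g, h'.
split=> [c Gc|x y Px Py c Gc].
  by exists c, 1; split=> //; [exact: hH.1|rewrite mulg1 mul1g].
have [g [c' [Gg Hc' E]]] := Px c Gc; have [g' [c2 [Gg' Hc2 E']]] := Py g Gg.
exists g', (c' * c2); split=> //; first exact: hH.2.
by rewrite -mulgA E' !mulgA E.
Qed.

Lemma rtri_bij h : H h -> set_bij G G (rtri G H h).
Proof.
move=> Hh; split=> [g _||a Ga]; [exact: rtri_G|exact: rtri_inj|].
have [g [h' [Gg Hh' E]]] := rtri_surj Hh Ga; exists g => //.
by rewrite /rtri E factorE.
Qed.

End Actions.

(** * Transfer to the other actions *)

Lemma opposite_factor (K : monoidType) (G H : set K) (k : K) : Zappa_Szep G H ->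
  factor (H : set (opposite K)) (G : set (opposite K)) (k : opposite K) =
  ((factor G H k).2, (factor G H k).1).
Proof.
move=> Z; have [Gg Hh kE] := factorP Z k.
rewrite {1}kE; exact: (factorE (opposite_Zappa_Szep (Zappa_SzepC Z)) Hh Gg).
Qed.

Lemma ltri_bij (K : monoidType) (G H : set K) (D g : K) :
  submonoid G -> submonoid H -> Zappa_Szep G H -> Garside_structure D -> G g ->
  set_bij H H (fun h => ltri G H h g).
Proof.
move=> hG hH hK garside Gg.
have -> : (fun h => ltri G H h g) =
    rtri (H : set (opposite K)) (G : set (opposite K)) g.
  by apply/funext => h; rewrite /rtri opposite_factor.
apply: (@rtri_bij (opposite K) H G D) => //; try exact/opposite_submonoid.
  exact/opposite_Zappa_Szep/Zappa_SzepC.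
exact: opposite_Garside.
Qed.

Theorem lemma32 (K : monoidType) (G H : set K)
    (hG : submonoid G) (hH : submonoid H)
    (hK : Zappa_Szep G H) (hGar : Garside_monoid K) :
  (forall h : K, H h ->
     set_bij G G (fun g => rtri G H h g) /\
     set_bij G G (fun g => bltri G H g h)) /\
  (forall g : K, G g ->
     set_bij H H (fun h => ltri G H h g) /\
     set_bij H H (fun h => brtri G H g h)).
Proof.
(* By definition, [bltri G H] and [brtri G H] are [ltri H G] and [rtri H G], so exchanging the
   submonoids handles both. *)
have [D garside] := hGar; have hK' := Zappa_SzepC hK.
split=> [h Hh|g Gg]; split.
- exact: (rtri_bij hG hH hK garside Hh).
- exact: (ltri_bij hH hG hK' garside Hh).
- exact: (ltri_bij hG hH hK garside Gg).
- exact: (rtri_bij hH hG hK' garside Gg).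
Qed.
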